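(* Let $1<n\leq m$ be integers. If $2\mid(m-n)$ or $n\leq\lceil\frac{m+1}{2}\rceil$, then $$\operatorname{ecc}_{Z_{n,m}}(0)=d(u^{(0)},0)=\binom{\lfloor\frac{m+n}{2}\rfloor+1}{2}+\binom{\lceil\frac{m-n}{2}\rceil+1}{2}.$$ Otherwise, $$\operatorname{ecc}_{Z_{n,m}}(0)=d(u^{(1)},0)=d(u^{(0)},0)+n-\lceil\tfrac{m+1}{2}\rceil.$$
   Context: Elements of $\mathbb{Z}_n$ are identified with their representatives in $\{0,\dots,n-1\}$. The dYoke graph $Z_{n,m}$ has as vertices all $u=(u_0,\dots,u_{m+1})\in\mathbb{Z}_n\times\{-1,0,1\}^m\times\mathbb{Z}_n$ with $\sum_{i=0}^{m+1}u_i\equiv0\pmod n$; $u,v$ are adjacent if there is $0\leq i\leq m$ such that $u_j=v_j$ for all $j\notin\{i,i+1\}$ and either ($u_i=v_i+1$, $u_{i+1}=v_{i+1}-1$) or ($u_i=v_i-1$, $u_{i+1}=v_{i+1}+1$), arithmetic in coordinates $0,m+1$ being in $\mathbb{Z}_n$. $0$ is the all-zero vertex, $d$ is graph distance in $Z_{n,m}$, $\operatorname{ecc}_{Z_{n,m}}(0)=\max_v d(v,0)$. $u^{(0)}$ is the vertex with $u_i=1$ for $1\leq i\leq m$ and $u_0\equiv-\lfloor\frac{m-n}{2}\rfloor\pmod n$ (and $u_{m+1}$ determined by the sum condition). When $n<m$ and $m-n$ is odd, $u^{(1)}$ is the vertex with $u_{\lceil (m+1)/2\rceil}=0$, $u_i=1$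 for all other $1\leq i\leq m$, and $u_0\equiv-\lfloor\frac{m-n}{2}\rfloor\pmod n$. *)

(* Defs.v *)
From mathcomp Require Import all_boot all_order all_algebra.
Unset Printing Implicit Defensive.
Import GRing.Theory Num.Theory.
Local Open Scope ring_scope.

(* A candidate vertex of Z_{n,m}: a function on indices 0..m+1 with integer
   values; coordinates 0 and m+1 are Z_n-elements stored by their
   representatives in {0,..,n-1}. *)
Definition coords (m : nat) := {ffun 'I_m.+2 -> int}.

Definition is_end (m : nat) (i : 'I_m.+2) : bool := (val i == 0%N) || (val i == m.+1).

Definition is_vertex (n m : nat) (u : coords m) : bool :=
  [forall i : 'I_m.+2,
     if is_end m i then (0 <= u i) && (u i < n%:Z)
     else (u i == -1) || (u i == 0) || (u i == 1)]
  && (n%:Z %| \sum_(i < m.+2) u i)%Z.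

Definition eqc (n m : nat) (i : 'I_m.+2) (a b : int) : bool :=
  if is_end m i then (a == b %[mod n%:Z])%Z else a == b.

Definition adj (n m : nat) : rel (coords m) := fun u v =>
  [&& is_vertex n m u, is_vertex n m v &
  [exists i : 'I_m.+1,
     [forall j : 'I_m.+2, (val j != val i) && (val j != (val i).+1) ==> (u j == v j)] &&
     (let i0 : 'I_m.+2 := inord (val i) in
      let i1 : 'I_m.+2 := inord (val i).+1 in
      (eqc n m i0 (u i0) (v i0 + 1) && eqc n m i1 (u i1) (v i1 - 1))
      || (eqc n m i0 (u i0) (v i0 - 1) && eqc n m i1 (u i1) (v i1 + 1)))]].

Definition walk (n m : nat) (u v : coords m) (p : seq (coords m)) : Prop :=
  is_vertex n m u /\ path (adj n m) u p /\ last u p = v.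

Definition is_dist (n m : nat) (u v : coords m) (k : nat) : Prop :=
  (exists p, walk n m u v p /\ size p = k) /\
  (forall p, walk n m u v p -> (k <= size p)%N).

Definition zero_v (m : nat) : coords m := [ffun => 0].

Definition ecc0_is (n m K : nat) : Prop :=
  (forall v, is_vertex n m v -> exists k, is_dist n m v (zero_v m) k /\ (k <= K)%N) /\
  (exists v, is_vertex n m v /\ is_dist n m v (zero_v m) K).

Definition u0_first (n m : nat) : int := ((- ((m - n)./2)%:Z) %% n%:Z)%Z.
Definition u0 (n m : nat) : coords m :=
  [ffun i : 'I_m.+2 =>
     if val i == 0%N then u0_first n m
     else if val i == m.+1 then ((- (u0_first n m + m%:Z)) %% n%:Z)%Z
     else 1].

(* u^(1): coordinate ceil((m+1)/2) = (m+2)/2 set to 0 *)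
Definition u1 (n m : nat) : coords m :=
  [ffun i : 'I_m.+2 =>
     if val i == 0%N then u0_first n m
     else if val i == m.+1 then ((- (u0_first n m + (m%:Z - 1))) %% n%:Z)%Z
     else if val i == (m.+2)./2 then 0
     else 1].

(* Main.v *)
(* The partial sums of a vertex form an integer sequence s_0, ..., s_m with steps
   in {-1, 0, 1}, well defined up to adding a common multiple of n, and a move
   changes a single s_i by 1. Hence d(u, 0) is the minimum over k of
   sum_i |s_i - k n|.
   For the upper bound, take k such that p = #{s_i < k n} and
   q = #{s_i > (k + 1) n} are both at most (m + 1) / 2, and let
   a = floor((m - n) / 2). The values of s fill an interval, so p > a gives
   sum_i |s_i - k n| <= C(p + 1, 2) + C(m - p + 1, 2), which decreases for
   p <= m / 2 and is bounded by d(u0, 0); q > a is symmetric for k + 1. If p, q <= a, the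
   average of the two costs is at most (n (m + 1) + 2 a (a + 1)) / 2. *)
Require Import Defs.
From mathcomp Require Import all_boot all_order all_algebra.
From mathcomp Require Import zify.
From Stdlib Require Import Classical.
Import Order.TTheory GRing.Theory Num.Theory.
Local Open Scope ring_scope.

(** * Vertices and moves as integer sequences *)

Definition lip (m : nat) (s : nat -> int) : Prop :=
  forall i, (i < m)%N -> (`|s i.+1 - s i| <= 1)%N.

(** Reading [s] as 0 before index 0 and after index [m] gives [m + 2] differences that telescope to
    0: the sum condition before reduction mod [n]. *)
Definition raw (m : nat) (s : nat -> int) (i : nat) : int :=
  (if (i <= m)%N then s i else 0) - (if i is j.+1 then s j else 0).

Definition enc (n m : nat) (s : nat -> int) : coords m :=
  [ffun i : 'I_m.+2 =>
     if is_end m i then (raw m s i %% n%:Z)%Z else raw m s i].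

Definition upd (s : nat -> int) (i : nat) (e : int) : nat -> int :=
  fun j => if j == i then s j + e else s j.

Definition cost (m : nat) (s : nat -> int) (x : int) : nat :=
  (\sum_(i < m.+1) `|s i - x|)%N.

Lemma raw_upd (m i j : nat) (s : nat -> int) (e : int) : (i <= m)%N ->
  raw m (upd s i e) j =
    raw m s j + (if j == i then e else if j == i.+1 then - e else 0).
Proof.
rewrite /raw /upd => im.
by case: j => [|j] /=; repeat (case: ifP => ?); lia.
Qed.

Lemma sum_raw (m : nat) (s : nat -> int) : \sum_(i < m.+2) raw m s i = 0.
Proof.
rewrite -(big_mkord predT (raw m s)).
rewrite (telescope_sumr_eq (fun i => if i is j.+1 then
    (if (j <= m)%N then s j else 0) else 0)) //=; last first.
  by case=> [|k] km //; rewrite /raw (_ : (k <= m)%N) //; lia.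
by rewrite ltnn subr0.
Qed.

Lemma eqz_mod_range (n a b : int) : 0 <= a < n -> (a = b %[mod n])%Z ->
  a = (b %% n)%Z.
Proof. by move=> an <-; rewrite modz_small. Qed.

Lemma enc_vertex (n m : nat) (s : nat -> int) : (0 < n)%N -> lip m s ->
  is_vertex n m (enc n m s).
Proof.
move=> n0 ls; apply/andP; split.
  apply/forallP => i; rewrite ffunE; case: ifP => e; rewrite e; first by lia.
  move: e; rewrite /is_end /raw; case: i => -[|i] i_lt //= /negbT im.
  have im' : (i < m)%N by lia.
  by rewrite im'; have := ls i im'; lia.
(* Only the multiples of [n] removed by the reduction at the two ends remain. *)
have -> : \sum_(i < m.+2) enc n m s i =
    \sum_(i < m.+2) (enc n m s i - raw m s i).
  by rewrite sumrB sum_raw subr0.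
apply: rpred_sum => i _; rewrite ffunE; case: ifP => _.
  rewrite [X in _ - X](divz_eq (raw m s i) n) opprD addrCA subrr addr0.
  by rewrite rpredN dvdz_mull.
by rewrite subrr rpred0.
Qed.

Lemma eqc_enc (n m : nat) (s t : nat -> int) (d : int) (i : 'I_m.+2) :
  raw m s i = raw m t i + d -> eqc n m i (enc n m s i) (enc n m t i + d).
Proof.
by rewrite /eqc !ffunE => ->; case: ifP => e; rewrite e // modz_mod modzDml.
Qed.

(** An end coordinate of a vertex is a representative in [[0, n)], so the congruence in [eqc]
    already determines it. *)
Lemma eqc_encr (n m : nat) (s t : nat -> int) (v : coords m) (d : int)
    (i : 'I_m.+2) : is_vertex n m v -> raw m t i = raw m s i - d ->
  eqc n m i (enc n m s i) (v i + d) -> v i = enc n m t i.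
Proof.
case/andP=> /forallP/(_ i) vi _; rewrite /eqc !ffunE => ->.
case: ifP vi => ie; rewrite ?ie => vi; last by move=> /eqP ->; rewrite addrK.
rewrite modz_mod => /eqP e; apply: eqz_mod_range vi _.
by rewrite -{1}(addrK d (v i)) -[LHS]modzDml -e modzDml.
Qed.

(** The entry [s i] enters coordinate [i] with sign + and coordinate [i + 1] with sign -, so
    changing it by 1 is a move on these two coordinates. *)
Lemma adj_upd (n m i : nat) (s : nat -> int) (e : int) : (0 < n)%N ->
  (i <= m)%N -> e = 1 \/ e = -1 -> lip m s -> lip m (upd s i e) ->
  adj n m (enc n m s) (enc n m (upd s i e)).
Proof.
move=> n0 im e1 ls ls'; rewrite /adj !enc_vertex //=.
have i_lt : (i < m.+1)%N by [].
apply/existsP; exists (Ordinal i_lt); apply/andP; split=> /=.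
  apply/forallP=> j; apply/implyP=> /andP[/negbTE ji /negbTE jSi].
  by rewrite !ffunE raw_upd // ji jSi addr0.
have i0 : nat_of_ord (inord i : 'I_m.+2) = i by rewrite inordK //; lia.
have i1 : nat_of_ord (inord i.+1 : 'I_m.+2) = i.+1 by rewrite inordK //; lia.
apply/orP; case: e1 => ->; [right|left]; apply/andP; split; apply: eqc_enc;
  rewrite ?i0 ?i1 raw_upd // eqxx ?(gtn_eqF (ltnSn i)); lia.
Qed.

Lemma adj_enc (n m : nat) (s : nat -> int) (v : coords m) :
  adj n m (enc n m s) v ->
  exists i e, [/\ (i <= m)%N, e = 1 \/ e = -1 & v = enc n m (upd s i e)].
Proof.
case/and3P=> _ vv /existsP[i /andP[/forallP same move_i]].
have i_le : (i <= m)%N by rewrite -ltnS.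
have i0 : nat_of_ord (inord i : 'I_m.+2) = i by rewrite inordK //; lia.
have i1 : nat_of_ord (inord i.+1 : 'I_m.+2) = i.+1 by rewrite inordK //; lia.
have suff_e e : (e = 1 \/ e = -1) ->
    eqc n m (inord i) (enc n m s (inord i)) (v (inord i) - e) ->
    eqc n m (inord i.+1) (enc n m s (inord i.+1)) (v (inord i.+1) + e) ->
    exists i e, [/\ (i <= m)%N, e = 1 \/ e = -1 & v = enc n m (upd s i e)].
  move=> e1 c0 c1; exists (val i), e; split=> //; apply/ffunP => j.
  case: (eqVneq (val j) (val i)) => [ji|ji].
    have {}ji : j = inord i by apply: val_inj; rewrite /= i0.
    rewrite ji; apply: eqc_encr vv _ c0.
    by rewrite raw_upd // i0 eqxx opprK.
  case: (eqVneq (val j) (val i).+1) => [jSi|jSi].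
    have {}jSi : j = inord i.+1 by apply: val_inj; rewrite /= i1.
    rewrite jSi; apply: eqc_encr vv _ c1.
    by rewrite raw_upd // i1 (gtn_eqF (ltnSn i)) eqxx.
  have := same j; rewrite ji jSi /= => /eqP <-.
  by rewrite !ffunE raw_upd // (negbTE ji) (negbTE jSi) addr0.
case/orP: move_i => /andP[c0 c1].
  by apply: (suff_e (-1)); [right | rewrite opprK | ].
by apply: (suff_e 1); [left | | ].
Qed.

(** * Distance to the zero vertex as a minimal cost *)

Lemma cost_upd (m i : nat) (s : nat -> int) (e x : int) : (i <= m)%N ->
  (cost m (upd s i e) x + `|s i - x| = cost m s x + `|(s i + e - x)%R|)%N.
Proof.
rewrite -ltnS => im; rewrite /cost (bigD1 (Ordinal im)) //=.
rewrite [in RHS](bigD1 (Ordinal im)) //= /upd eqxx.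
under eq_bigr => j ji.
  rewrite (_ : (nat_of_ord j == i) = false); last exact/negbTE.
  over.
lia.
Qed.

(** Each step of a walk lifts to a unit change of one entry. The bound is uniform in [x] because the
    multiple of [n] reached by a walk to 0 is known only at its end. *)
Lemma walk_cost (n m : nat) (s : nat -> int) (p : seq (coords m)) :
  path (adj n m) (enc n m s) p -> exists t,
    last (enc n m s) p = enc n m t /\
    forall x, (cost m s x <= cost m t x + size p)%N.
Proof.
elim: p s => [|v p IHp] s /=; first by exists s; split=> // x; lia.
case/andP=> /adj_enc[i [e [im e1 ->]]] /IHp[t [-> le_t]].
exists t; split=> // x; have := le_t x; have := cost_upd m i s e x im; lia.
Qed.

Lemma enc_zero (n m : nat) (s : nat -> int) : enc n m s = zero_v m ->
  exists k : int, forall i, (i <= m)%N -> s i = k * n%:Z.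
Proof.
move=> s0; have at_i i : (i <= m)%N -> enc n m s (inord i) = 0.
  by move=> _; rewrite s0 ffunE.
have /dvdzP[k s0k] : (n %| s 0%N)%Z.
  have := at_i 0%N isT; rewrite ffunE /is_end /raw /= !inordK //= subr0.
  by move=> ?; apply/dvdz_mod0P.
exists k; elim=> [|i IHi] // im; rewrite -IHi; last exact: ltnW.
have := at_i i.+1 im; rewrite ffunE /is_end /raw /= !inordK; [|lia..].
by rewrite im (_ : (_ == _) || _ = false); lia.
Qed.

Lemma walk_zero_cost (n m : nat) (s : nat -> int) (p : seq (coords m)) :
  walk n m (enc n m s) (zero_v m) p ->
  exists k : int, (cost m s (k * n%:Z) <= size p)%N.
Proof.
case=> _ [/walk_cost[t [-> le_t]] /enc_zero[k tk]]; exists k.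
apply: leq_trans (le_t _) _; rewrite /cost big1 // => i _.
by rewrite tk ?subrr // -ltnS.
Qed.

(* Pushing an entry of largest absolute value towards 0 keeps [s] Lipschitz. *)
Lemma cost_walk (n m : nat) (s : nat -> int) : (0 < n)%N -> lip m s ->
  exists p, walk n m (enc n m s) (zero_v m) p /\ size p = cost m s 0.
Proof.
move=> n0; move c: (cost m s 0) => N; elim: N s c => [|N IHN] s c ls.
  exists [::]; split=> //; split; first exact: enc_vertex.
  split=> //=; have si i : (i <= m)%N -> s i = 0.
    rewrite -ltnS => im; move/eqP: c; rewrite sum_nat_eq0.
    by move=> /forallP/(_ (Ordinal im)) /=; lia.
  apply/ffunP => i; rewrite !ffunE (_ : raw m s i = 0) ?mod0z ?if_same //.
  rewrite /raw; case: i => -[|i] i_lt /=; first by rewrite si.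
  by case: ifP => im; rewrite ?si //; lia.
have [i [im i_max]] : exists i, (i <= m)%N /\
    forall j, (j <= m)%N -> (`|s j| <= `|s i|)%N.
  case: (@arg_maxnP _ (ord0 : 'I_m.+1) predT (fun i => `|s i|%N)) => //.
  move=> i _ i_max.
  exists i; split=> [|j]; first by rewrite -ltnS.
  by rewrite -ltnS => jm; apply: (i_max (Ordinal jm)).
have si0 : s i != 0.
  apply/eqP => si0; suff: cost m s 0 = 0%N by rewrite c.
  by apply: big1 => j _; have := i_max j (ltn_ord j); rewrite si0; lia.
have [e e1 eE] : exists2 e : int, e = 1 \/ e = -1 & `|s i + e|%R = `|s i|%R - 1.
  case: (ltrP 0 (s i)) => ?; first by exists (-1); [right|lia].
  by exists 1; [left|lia].
have ls' : lip m (upd s i e).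
  move=> j jm; have := ls j jm; have := i_max j (ltnW jm).
  have := i_max j.+1 jm; rewrite /upd.
  case: (eqVneq j i) => [ji|_]; last case: (eqVneq j.+1 i) => [ji|_] //.
    by rewrite ji (gtn_eqF (ltnSn i)); lia.
  by rewrite ji; lia.
have [|p [[_ [path_p last_p]] size_p]] := IHN (upd s i e) _ ls'.
  by have := cost_upd m i s e 0 im; rewrite c; lia.
exists (enc n m (upd s i e) :: p); split; last by rewrite /= size_p.
split; first exact: enc_vertex.
by split=> //=; rewrite adj_upd.
Qed.

(** A constant shift cancels in the inner differences and survives only in the two end coordinates,
    which are read mod [n]. *)
Lemma enc_shift (n m : nat) (s : nat -> int) (k : int) :
  enc n m (fun i => s i - k * n%:Z) = enc n m s.
Proof.
apply/ffunP => i; rewrite !ffunE /is_end /raw.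
case: i => -[|i] i_lt //=; first by rewrite !subr0 -mulNr addrC modzMDl.
rewrite eqSS; case: ltngtP => im //; try lia.
by rewrite !sub0r opprB modzMDl.
Qed.

Lemma cost_shift (m : nat) (s : nat -> int) (x y : int) :
  cost m (fun i => s i - y) x = cost m s (y + x).
Proof. by apply: eq_bigr => i _; congr absz; rewrite opprD addrA. Qed.

Lemma lip_shift (m : nat) (s : nat -> int) (y : int) : lip m s ->
  lip m (fun i => s i - y).
Proof. by move=> ls i /ls; lia. Qed.

(** Lifting a walk to 0 bounds its length below by some cost at [l * n]; descending to 0 from the
    lift shifted by [k * n] attains the cost at [k * n]. *)
Lemma is_dist_enc (n m K : nat) (s : nat -> int) (k : int) : (0 < n)%N ->
    lip m s -> cost m s (k * n%:Z) = K ->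
    (forall l : int, (K <= cost m s (l * n%:Z))%N) ->
  is_dist n m (enc n m s) (zero_v m) K.
Proof.
move=> n0 ls <- k_min; split.
  have [p] := cost_walk n m _ n0 (lip_shift m s (k * n%:Z) ls).
  by rewrite enc_shift cost_shift addr0 => ?; exists p.
by move=> p /walk_zero_cost[l]; apply: leq_trans (k_min l).
Qed.

(** An optimal multiple exists by descent: one that is not optimal is replaced by one of strictly
    smaller cost, a natural number. *)
Lemma dist_enc_le (n m : nat) (s : nat -> int) (k : int) : (0 < n)%N ->
  lip m s -> exists K, is_dist n m (enc n m s) (zero_v m) K /\
    (K <= cost m s (k * n%:Z))%N.
Proof.
move=> n0 ls; move: {2}(cost _ _ _) (leqnn (cost m s (k * n%:Z))) => N.
elim: N k => [|N IHN] k kN;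
  (case: (classic
    (forall l : int, (cost m s (k * n%:Z) <= cost m s (l * n%:Z))%N))
    => [k_min|/not_all_ex_not[l /negP kl]];
  first by exists (cost m s (k * n%:Z)); split=> //; apply: is_dist_enc k_min).
  by lia.
by have [|K [dK ?]] := IHN l; [lia | exists K; split=> //; lia].
Qed.

Lemma vertex_enc (n m : nat) (u : coords m) : is_vertex n m u ->
  exists2 s, lip m s & u = enc n m s.
Proof.
case/andP=> /forallP u_range u_sum.
pose s i := \sum_(j < i.+1) u (inord j).
have sS i : s i.+1 = s i + u (inord i.+1) by rewrite /s big_ord_recr.
exists s => [i im|].
  have := u_range (inord i.+1); rewrite sS /is_end /= inordK; last by lia.
  by rewrite eqSS (ltn_eqF im) /=; lia.
apply/ffunP => i; rewrite ffunE; have := u_range i.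
rewrite -(inord_val i); case: i => -[|i] i_lt;
  rewrite /is_end /raw /= !inordK //=.
  by rewrite subr0 /s big_ord1 => ?; rewrite modz_small.
rewrite eqSS; case: ltngtP => im //=; first by rewrite sS addrC addKr.
  by move: i_lt; rewrite !ltnS leqNgt im.
(* The last coordinate enters no partial sum; the sum condition makes it congruent to [- s m]. *)
move: u_sum; rewrite big_ord_recr /= => /dvdzP[q uq].
have {uq} -> : u (inord i.+1) = - s i + q * n%:Z.
  rewrite -uq im (_ : inord m.+1 = ord_max); last first.
    by apply: val_inj; rewrite /= inordK.
  rewrite (_ : \sum_(j < m.+1) _ = s m) ?addKr //; apply: eq_bigr => j _.
  by congr (u _); apply: val_inj; rewrite /= inordK //; have := ltn_ord j; lia.
by move=> /modz_small <-; rewrite sub0r addrC modzMDl.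
Qed.

(** * Upper bounds on the cost from values that fill an interval *)

Lemma double_bin2S (x : nat) : (2 * 'C(x.+1, 2) = x * x.+1)%N.
Proof. by rewrite -(mul_bin_diag x.+1 1) bin1 mulnC. Qed.

(** All of [0, ..., x] occur for the largest value [x], so [x < size t]. Removing one copy of [x]
    keeps the list downward closed, and induction gives at most [0 + 1 + ... + (size t - 1)]. *)
Lemma sumn_downset (t : seq nat) : (forall v, v.+1 \in t -> v \in t) ->
  (sumn t <= 'C(size t, 2))%N.
Proof.
elim: {t}(size t) {-2}t (erefl (size t)) => [|k IHk] t size_t down.
  by rewrite (size0nil size_t).
have [x xt x_max] : exists2 x, x \in t & forall y, y \in t -> (y <= x)%N.
  have := permEl (perm_sort geq t).
  have := sort_sorted (fun x y => leq_total y x) t.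
  case: (sort geq t) => [|x r] st pt.
    by have := perm_size pt; rewrite size_t.
  exists x => [|y]; first by rewrite -(perm_mem pt) mem_head.
  rewrite -(perm_mem pt) inE => /orP[/eqP -> //|yr].
  have geq_trans : transitive geq by move=> ? ? ? h1 h2; apply: leq_trans h2 h1.
  by have /allP/(_ y yr) := order_path_min geq_trans st.
have down_x y : (y <= x)%N -> y \in t.
  move=> yx; rewrite -(subKn yx).
  elim: (x - y)%N => [|d IHd]; first by rewrite subn0.
  have [dx|dx] := ltnP d x; first by apply: down; rewrite subnSK.
  by move: IHd; rewrite (eqP dx) (eqP (leqW dx)).
have x_lt : (x < size t)%N.
  rewrite -(size_iota 0 x.+1); apply: uniq_leq_size (iota_uniq _ _) _ => y.
  by rewrite mem_iota => /andP[_ yx]; apply: down_x.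
have size_rem : size (rem x t) = k by rewrite size_rem // size_t.
have := IHk (rem x t) size_rem.
rewrite (perm_sumn (perm_to_rem xt)) /= size_rem size_t binS bin1 => le_rem.
rewrite addnC leq_add //; last by rewrite -ltnS -size_t.
apply: le_rem => v vr.
have vx : v != x.
  by apply/eqP => vx; have := x_max _ (mem_rem vr); rewrite vx ltnn.
have := down _ (mem_rem vr); rewrite (perm_mem (perm_to_rem xt)) inE.
by rewrite (negbTE vx).
Qed.

(** A step of size at most 1 cannot jump over [y], so if [y] is missed, all entries lie on the same
    side of it. *)
Lemma lip_ivt (m i j : nat) (s : nat -> int) (y : int) : lip m s ->
  (i <= m)%N -> (j <= m)%N -> s i <= y <= s j ->
  exists2 l, (l <= m)%N & s l = y.
Proof.
move=> ls im jm /andP[siy ysj]; apply: NNPP => not_y.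
have ne l : (l <= m)%N -> s l != y.
  by move=> lm; apply/eqP => ?; case: not_y; exists l.
have same l : (l <= m)%N -> (s l < y) = (s 0%N < y).
  elim: l => // l IHl lm; rewrite -IHl; last exact: ltnW.
  by have := ls l lm; have := ne _ lm; have := ne _ (ltnW lm); lia.
by have := same _ im; have := same _ jm; have := ne _ im; lia.
Qed.

Lemma sum_nneg_le (m j : nat) (s : nat -> int) : lip m s -> (j <= m)%N ->
  s j <= 0 ->
  (\sum_(i < m.+1 | (0 <= s i)%R) `|s i|
    <= 'C(#|[pred i : 'I_m.+1 | (0 <= s i)%R]|, 2))%N.
Proof.
move=> ls jm sj.
pose t :=
  [seq `|s (val i)|%N | i : 'I_m.+1 in [pred i : 'I_m.+1 | (0 <= s i)%R]].
have <- : size t = #|[pred i : 'I_m.+1 | (0 <= s i)%R]| by rewrite size_image.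
have -> : (\sum_(i < m.+1 | (0 <= s i)%R) `|s i|)%N = sumn t.
  by rewrite sumnE big_image.
apply: sumn_downset => v /imageP[i]; rewrite inE => si /= vi.
have [|l lm sl] := lip_ivt m j i s v%:Z ls jm (ltn_ord i); first by lia.
by apply/imageP; exists (inord l); rewrite ?inE /= inordK // sl.
Qed.

Lemma sum_neg_le (m j : nat) (s : nat -> int) : lip m s -> (j <= m)%N ->
  0 <= s j ->
  (\sum_(i < m.+1 | (s i < 0)%R) `|s i|
    <= 'C(#|[pred i : 'I_m.+1 | (s i < 0)%R]|.+1, 2))%N.
Proof.
(* The map [x -> - x - 1] sends negative values to nonnegative ones. Undoing its shift costs 1 per
   entry, and [C(p, 2) + p = C(p + 1, 2)]. *)
move=> ls jm sj; have lt' : lip m (fun i => - s i - 1) by move=> i /ls; lia.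
have := sum_nneg_le m j _ lt' jm.
have negE i : (0 <= - s i - 1) = (s i < 0) by lia.
rewrite (eq_bigl _ _ (fun i : 'I_m.+1 => negE i)).
rewrite (eq_card (B := [pred i : 'I_m.+1 | (s i < 0)%R])); last first.
  by move=> i; rewrite !inE negE.
rewrite binS bin1 => le1.
apply: (@leq_trans (\sum_(i < m.+1 | (s i < 0)%R) (`|(- s i - 1)%R| + 1))%N).
  by apply: leq_sum => i; lia.
by rewrite big_split /= sum1_card leq_add //; apply: le1; lia.
Qed.

(** The bounds on [p] make both signs occur, so the values on each side fill an interval starting
    next to 0. *)
Lemma cost_half (m : nat) (s : nat -> int) (p : nat) : lip m s ->
  #|[pred i : 'I_m.+1 | (s i < 0)%R]| = p -> (0 < p <= m)%N ->
  (cost m s 0 <= 'C(p.+1, 2) + 'C((m - p).+1, 2))%N.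
Proof.
move=> ls pE /andP[p0 pm].
have [j sj] : exists j : 'I_m.+1, s j < 0.
  by move: p0; rewrite -pE => /card_gt0P[j]; rewrite inE => ?; exists j.
have card_nneg : #|[pred i : 'I_m.+1 | (0 <= s i)%R]| = (m - p).+1.
  have := cardC [pred i : 'I_m.+1 | (s i < 0)%R]; rewrite card_ord pE.
  rewrite (eq_card (A := predC _)
    (B := [pred i : 'I_m.+1 | (0 <= s i)%R])); first last.
  by move=> i; rewrite !inE -leNgt.
  by move=> e; rewrite -[LHS](addKn p) e subSn.
have [l sl] : exists l : 'I_m.+1, 0 <= s l.
  have: (0 < #|[pred i : 'I_m.+1 | (0 <= s i)%R]|)%N by rewrite card_nneg.
  by case/card_gt0P => l; rewrite inE => ?; exists l.
have := sum_nneg_le m j s ls (ltn_ord j) (ltW sj); rewrite card_nneg => le1.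
have := sum_neg_le m l s ls (ltn_ord l) sl; rewrite pE => le2.
rewrite /cost (bigID (fun i : 'I_m.+1 => s i < 0)) /=.
rewrite leq_add //.
  by under eq_bigr => i _ do rewrite subr0.
under eq_bigr => i _ do rewrite subr0.
by under eq_bigl => i do rewrite -leNgt.
Qed.

Lemma cost_reflect (m : nat) (s : nat -> int) (y x : int) :
  cost m (fun i => y - s i) x = cost m s (y - x).
Proof. by apply: eq_bigr => i _; lia. Qed.

(** Pointwise [|x| + |x - n| = n + 2 max(-x, 0) + 2 max(x - n, 0)]; the two excess sums are negative
    parts, of [s] and of [n - s]. *)
Lemma cost_average (n m Q : nat) (s : nat -> int) : lip m s ->
  (Q <= m)%N ->
  (#|[pred i : 'I_m.+1 | (s i < 0)%R]| <= Q)%N ->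
  (#|[pred i : 'I_m.+1 | (n%:Z < s i)%R]| <= Q)%N ->
  (cost m s 0 + cost m s n%:Z <= n * m.+1 + 2 * (Q * Q.+1))%N.
Proof.
move=> ls Qm pQ qQ.
have neg_part (t : nat -> int) : lip m t ->
    (#|[pred i : 'I_m.+1 | (t i < 0)%R]| <= Q)%N ->
    (2 * (\sum_(i < m.+1 | (t i < 0)%R) `|t i|) <= Q * Q.+1)%N.
  move=> lt tQ; rewrite -double_bin2S leq_pmul2l //.
  have [l tl] : exists l : 'I_m.+1, 0 <= t l.
    apply: NNPP => no; move: (leq_trans tQ Qm).
    rewrite (eq_card (B := predT)) ?card_ord ?ltnn // => i.
    by rewrite !inE; case: ltrP => // ti; case: no; exists i.
  by apply: leq_trans (sum_neg_le m l t lt (ltn_ord l) tl) _; apply: leq_bin2l.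
have := neg_part s ls pQ.
have lt : lip m (fun i => n%:Z - s i) by move=> i /ls; lia.
have := neg_part _ lt.
rewrite (eq_card (B := [pred i : 'I_m.+1 | (n%:Z < s i)%R])); last first.
  by move=> i; rewrite !inE subr_lt0.
move=> /(_ qQ) le2 le1.
suff -> : (cost m s 0 + cost m s n%:Z = n * m.+1 +
    2 * (\sum_(i < m.+1 | (s i < 0)%R) `|s i|) +
    2 * (\sum_(i < m.+1 | (n%:Z - s i < 0)%R) `|(n%:Z - s i)%R|))%N.
  by rewrite -addnA leq_add2l [leqRHS]mul2n -addnn leq_add.
have -> : (n * m.+1 = \sum_(i < m.+1) n)%N.
  by rewrite sum_nat_const card_ord mulnC.
rewrite !big_distrr /= [X in (_ + X + _)%N]big_mkcond.
rewrite [X in _ = (_ + X)%N]big_mkcond.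
rewrite /cost -!big_split; apply: eq_bigr => i _ /=.
by do 2 case: ifP; lia.
Qed.

(* The largest multiple [k n] with at most half of the entries below it. *)
Lemma pivot (n m : nat) (s : nat -> int) : (0 < n)%N -> exists k : int,
  (2 * #|[pred i : 'I_m.+1 | (s i < k * n%:Z)%R]| <= m.+1)%N /\
  (2 * #|[pred i : 'I_m.+1 | ((k + 1) * n%:Z < s i)%R]| <= m.+1)%N.
Proof.
move=> n0; pose N (k : int) := #|[pred i : 'I_m.+1 | (s i < k * n%:Z)%R]|.
pose B := (\max_(i < m.+1) `|s i|)%N.
have B_max (i : 'I_m.+1) : (`|s i| <= B)%N.
  exact: (leq_bigmax (F := fun i : 'I_m.+1 => `|s i|%N) i).
have low : N (- B%:Z) = 0%N.
  by apply: eq_card0 => i; rewrite !inE; have := B_max i; nia.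
have high : N (B%:Z + 1) = m.+1.
  rewrite -[RHS]card_ord; apply: eq_card => i; rewrite !inE.
  by have := B_max i; nia.
(* Offsetting by [B] turns the search over integers into one over naturals. The pivot is the
   predecessor of the least multiple with more than half of the entries below it. *)
have ex : exists j, (m.+1 < 2 * N (j%:Z - B%:Z)%R)%N.
  exists (2 * B + 1)%N; rewrite (_ : _ - _ = B%:Z + 1); last by lia.
  by rewrite high; lia.
case: (ex_minnP ex) => -[|j] gt_j min_j.
  by move: gt_j; rewrite sub0r low.
exists (j%:Z - B%:Z); split.
  by rewrite leqNgt; apply/negP => /min_j; rewrite ltnn.
have := cardC [pred i : 'I_m.+1 | (s i < (j.+1%:Z - B%:Z) * n%:Z)%R].
rewrite card_ord -/(N _) (_ : j%:Z - B%:Z + 1 = j.+1%:Z - B%:Z); last by lia.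
set C := #|_| => cC; set c := #|_|.
have : (c <= C)%N.
  by apply: subset_leq_card; apply/subsetP => i; rewrite !inE -leNgt => /ltW.
by lia.
Qed.

Lemma cost_bound (n m Q : nat) (s : nat -> int) : (0 < n)%N -> (Q <= m)%N ->
  lip m s ->
  exists k : int,
    (exists p, [/\ (Q < p)%N, (2 * p <= m.+1)%N &
      (cost m s (k * n%:Z) <= 'C(p.+1, 2) + 'C((m - p).+1, 2))%N]) \/
    (2 * cost m s (k * n%:Z) <= n * m.+1 + 2 * (Q * Q.+1))%N.
Proof.
move=> n0 Qm ls; have [k [p_half q_half]] := pivot n m s n0.
pose t i := s i - k * n%:Z; have lt : lip m t by apply: lip_shift.
have c0 : cost m t 0 = cost m s (k * n%:Z) by rewrite cost_shift addr0.
have c1 : cost m t n%:Z = cost m s ((k + 1) * n%:Z).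
  by rewrite cost_shift mulrDl mul1r.
have pE : #|[pred i : 'I_m.+1 | (t i < 0)%R]| =
    #|[pred i : 'I_m.+1 | (s i < k * n%:Z)%R]|.
  by apply: eq_card => i; rewrite !inE subr_lt0.
have qE : #|[pred i : 'I_m.+1 | (n%:Z < t i)%R]| =
    #|[pred i : 'I_m.+1 | ((k + 1) * n%:Z < s i)%R]|.
  by apply: eq_card => i; rewrite !inE /t; lia.
rewrite -pE in p_half; rewrite -qE in q_half.
have [Qp|pQ] := ltnP Q #|[pred i : 'I_m.+1 | (t i < 0)%R]|.
  exists k; left; exists #|[pred i : 'I_m.+1 | (t i < 0)%R]|; split=> //.
  rewrite -c0; apply: cost_half => //; lia.
have [Qq|qQ] := ltnP Q #|[pred i : 'I_m.+1 | (n%:Z < t i)%R]|.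
  exists (k + 1); left; exists #|[pred i : 'I_m.+1 | (n%:Z < t i)%R]|.
  (* Reflection turns the entries above [n] into negative ones, and the cost at [n] into the cost at
     0. *)
  split=> //; have := cost_half m (fun i => n%:Z - t i)
    #|[pred i : 'I_m.+1 | (n%:Z < t i)%R]|.
  rewrite cost_reflect subr0 c1; apply; last by lia.
    by move=> i /lt; lia.
  by apply: eq_card => i; rewrite !inE subr_lt0.
have := cost_average n m Q t lt Qm pQ qQ; rewrite c0 c1 => le_avg.
have [le01|lt10] := leqP (cost m s (k * n%:Z)) (cost m s ((k + 1) * n%:Z)).
  by exists k; right; lia.
by exists (k + 1); right; lia.
Qed.

(** * Costs of the ramp [0, 1, ..., M], and convexity *)

(** Since [i + 1 - (x + 1) = i - x], the two sums share all terms but the last one at [x] and the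
    first one at [x + 1]. *)
Lemma cost_ramp_step (M : nat) (x : int) :
  (cost M Posz (x + 1) + `|(M%:Z - x)%R| = cost M Posz x + `|(x + 1)%R|)%N.
Proof.
rewrite /cost big_ord_recl [in RHS]big_ord_recr /=.
rewrite (eq_bigr (fun i : 'I_M => `|i%:Z - x|%N)) => [|i _]; first by lia.
by rewrite /bump /=; lia.
Qed.

(** The ramp attains the bound of [cost_half]. *)
Lemma cost_ramp (M p : nat) : (p <= M)%N ->
  cost M Posz p%:Z = ('C(p.+1, 2) + 'C((M - p).+1, 2))%N.
Proof.
elim: p => [_|p IHp pM].
  rewrite subn0 -(bin2_sum M.+1) big_mkord; apply: eq_bigr => i _; lia.
have := cost_ramp_step M p%:Z; rewrite IHp; last exact: ltnW.
rewrite (_ : p%:Z + 1 = p.+1%:Z); last by lia.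
have -> : (M - p).+1 = (M - p.+1).+2 by lia.
rewrite (binS (M - p.+1).+1) (binS p.+1) !bin1; lia.
Qed.

(** The increment [|x + 1| - |M - x|] is nonnegative exactly when [M <= 2 * x + 1]. *)
Lemma cost_ramp_right (M : nat) (x y : int) : M%:Z <= 2 * x + 1 -> x <= y ->
  (cost M Posz x <= cost M Posz y)%N.
Proof.
move=> Mx xy; have -> : y = x + `|y - x|%N%:Z by lia.
elim: `|y - x|%N => [|d IHd]; first by rewrite addr0.
have := cost_ramp_step M (x + d%:Z).
by rewrite (_ : x + d%:Z + 1 = x + d.+1%:Z); lia.
Qed.

Lemma cost_ramp_left (M : nat) (x y : int) : 2 * x <= M%:Z + 1 -> y <= x ->
  (cost M Posz x <= cost M Posz y)%N.
Proof.
move=> Mx xy; have -> : y = x - `|y - x|%N%:Z by lia.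
elim: `|y - x|%N => [|d IHd]; first by rewrite subr0.
have := cost_ramp_step M (x - d.+1%:Z).
by rewrite (_ : x - d.+1%:Z + 1 = x - d%:Z); lia.
Qed.

Lemma sum_repeat (c m : nat) (g : nat -> nat) : (0 < c <= m)%N ->
  (\sum_(i < m.+1) g (i - (c <= i)) = \sum_(i < m) g i + g c.-1)%N.
Proof.
move=> /andP[c0 /subnK <-]; elim: (m - c)%N => [|d IHd].
  rewrite add0n big_ord_recr /= leqnn subn1; congr addn.
  by apply: eq_bigr => i _; rewrite leqNgt ltn_ord subn0.
rewrite addSn big_ord_recr IHd /= [in RHS]big_ord_recr /=.
by rewrite (_ : (c <= (d + c).+1)%N = true) ?subn1 /=; lia.
Qed.

(** Convexity of triangular numbers: [p] and [m - p] both lie between [P] and [m - P]. With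
    [p = P + d] and [m - p = P + f], the doubled sides differ by [2 d f]. *)
Lemma bin2_pair_le (m p P : nat) : (P <= p)%N -> (p + P <= m)%N ->
  ('C(p.+1, 2) + 'C((m - p).+1, 2) <= 'C(P.+1, 2) + 'C((m - P).+1, 2))%N.
Proof.
move=> Pp pPm; have e1 := double_bin2S p; have e2 := double_bin2S (m - p).
have e3 := double_bin2S P; have e4 := double_bin2S (m - P).
suff: (p * p.+1 + (m - p) * (m - p).+1 <= P * P.+1 + (m - P) * (m - P).+1)%N.
  by rewrite -e1 -e2 -e3 -e4 -!mulnDr leq_pmul2l.
clear e1 e2 e3 e4.
have [d pE] : exists d, p = (P + d)%N by exists (p - P)%N; lia.
have [f mE] : exists f, m = (P + (P + d) + f)%N by exists (m - p - P)%N; lia.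
subst p m.
have -> : (P + (P + d) + f - (P + d) = P + f)%N by lia.
have -> : (P + (P + d) + f - P = P + d + f)%N by lia.
nia.
Qed.

(** * The vertices [u0] and [u1] and their distances to 0 *)

Lemma modz_addN (d x y z : int) : x + y = z ->
  (- ((x %% d)%Z + y) = 0 - z %[mod d])%Z.
Proof.
move=> <-; rewrite -[LHS](modzMDl (- (x %/ d)%Z)); congr (_ %% _)%Z.
by rewrite {3}(divz_eq x d); lia.
Qed.

Lemma u0_enc (n m : nat) :
  u0 n m = enc n m (fun i => i%:Z - (m - n)./2%:Z).
Proof.
apply/ffunP => i; rewrite !ffunE /is_end /raw /u0_first.
case: i => -[|i] i_lt /=; first by rewrite sub0r subr0.
rewrite eqSS; case: ltngtP => im /=; [lia|lia|].
by apply: modz_addN; lia.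
Qed.

Lemma u1_enc (n m : nat) : (0 < (m.+2)./2 <= m)%N ->
  u1 n m = enc n m (fun i => (i - ((m.+2)./2 <= i))%N%:Z - (m - n)./2%:Z).
Proof.
move=> c_range; apply/ffunP => i; rewrite !ffunE /is_end /raw /u0_first.
case: i => -[|i] i_lt /=; first by rewrite sub0n sub0r subr0.
rewrite eqSS; case: ltngtP => im /=; [|lia|].
  by case: eqP; lia.
by apply: modz_addN; lia.
Qed.

Definition dist_u0 (n m : nat) : nat :=
  'C(((m + n)./2).+1, 2) + 'C(((m - n).+1./2).+1, 2).

Lemma dist_u0_ramp (n m : nat) : (n <= m)%N ->
  dist_u0 n m = cost m Posz ((m - n)./2 + n)%N.
Proof.
move=> n_le_m; rewrite cost_ramp /dist_u0; last by lia.
by congr ('C(_.+1, 2) + 'C(_.+1, 2))%N; lia.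
Qed.

(** Convexity with [P = ceil((m - n) / 2)], the smaller part in [dist_u0]: [p > floor((m - n) / 2)]
    gives [P <= p], and [2 * p <= m + 1] gives [p + P <= m]. *)
Lemma dist_u0_ge (n m p : nat) : (1 < n)%N -> (n <= m)%N ->
  ((m - n)./2 < p)%N -> (2 * p <= m.+1)%N ->
  ('C(p.+1, 2) + 'C((m - p).+1, 2) <= dist_u0 n m)%N.
Proof.
move=> n_gt1 n_le_m ap pm; rewrite dist_u0_ramp // cost_ramp; last by lia.
have := bin2_pair_le m p (m - ((m - n)./2 + n)); rewrite subKn; last by lia.
by move=> le; rewrite [leqRHS]addnC; apply: le; lia.
Qed.

Lemma u0_dist (n m : nat) : (1 < n)%N -> (n <= m)%N ->
  is_dist n m (u0 n m) (zero_v m) (dist_u0 n m).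
Proof.
move=> n_gt1 n_le_m; rewrite u0_enc dist_u0_ramp //.
(* On the ramp, the targets 0 and [n] sit at [a] and [a + n], on either side of [m / 2]. They are
   equally far from it if [m - n] is even, and [a + n] is nearer otherwise, so multiple 1 is
   optimal. *)
move aE: ((m - n)./2)%N => a; apply: (is_dist_enc _ _ _ _ 1).
- by lia.
- by move=> i; lia.
- by rewrite mul1r cost_shift.
move=> l; rewrite cost_shift; have [l1|l0] := lerP 1 l.
  apply: cost_ramp_right; first by lia.
  by rewrite PoszD lerD2l -[leLHS]mul1r ler_pM2r; lia.
have low : (cost m Posz a <= cost m Posz (a%:Z + l * n%:Z))%N.
  apply: cost_ramp_left; first by lia.
  have: l * n%:Z <= 0 by rewrite pmulr_lle0; lia.
  by lia.
apply: leq_trans low; rewrite !cost_ramp; try by lia.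
have := bin2_pair_le m (m - (a + n)) a; rewrite subKn; last by lia.
by move=> le; rewrite addnC; apply: le; lia.
Qed.

(* [u1] repeats the value [c - 1] of the ramp of length [m], [c] being the
   position of its zero. *)
Lemma u1_dist (n m : nat) : odd (m - n) -> (n <= m)%N -> ((m.+2)./2 < n)%N ->
  is_dist n m (u1 n m) (zero_v m) (dist_u0 n m + n - (m.+2)./2).
Proof.
move=> odd_mn n_le_m c_lt; rewrite u1_enc; last by lia.
move aE: ((m - n)./2)%N => a; move cE: ((m.+2)./2)%N c_lt => c c_lt.
have costE x : cost m (fun i => (i - (c <= i))%N%:Z - a%:Z) x =
    (cost m.-1 Posz (a%:Z + x) + `|(c%:Z - 1 - (a%:Z + x))%R|)%N.
  rewrite cost_shift.
  have := sum_repeat c m (fun i => `|(i%:Z - (a%:Z + x))%R|%N).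
  rewrite /cost => ->; last by lia.
  by rewrite prednK; [congr (_ + _)%N|]; lia.
(* Shortening the ramp by its last entry saves [m - (a + n) = a + 1]; the repeated value [c - 1]
   adds [a + n - (c - 1)]. *)
have valE : (dist_u0 n m + n - c =
    cost m.-1 Posz (a + n)%N + (n + a + 1 - c))%N.
  rewrite dist_u0_ramp // aE !cost_ramp; try lia.
  have -> : (m - (a + n)).+1 = (m.-1 - (a + n)).+2 by lia.
  by rewrite (binS (m.-1 - (a + n)).+1) bin1; lia.
rewrite {}valE; apply: (is_dist_enc _ _ _ _ 1).
- by lia.
- by move=> i; lia.
- by rewrite mul1r costE; congr (_ + _)%N; lia.
move=> l; rewrite costE; have [l1|l0] := lerP 1 l.
  have ln : n%:Z <= l * n%:Z by rewrite -[leLHS]mul1r ler_pM2r; lia.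
  by apply: leq_add; [apply: cost_ramp_right|]; lia.
have ln : l * n%:Z <= 0 by rewrite pmulr_lle0; lia.
(* As [2 * c >= m + 1 = n + 2 * a + 2], the value [c - 1] is at least as far from [a] as from
   [a + n]. These two targets are mirror images in the shorter ramp, because [m - 1 = 2 * a + n]. *)
apply: leq_add; last by lia.
have low : (cost m.-1 Posz a <= cost m.-1 Posz (a%:Z + l * n%:Z))%N.
  by apply: cost_ramp_left; lia.
apply: leq_trans low; rewrite !cost_ramp; try by lia.
by rewrite addnC; apply: eq_leq; congr ('C(_.+1, 2) + 'C(_.+1, 2))%N; lia.
Qed.

(** * The eccentricity of the zero vertex *)

(** The two numerical conditions match the two outcomes of [cost_bound]. The slack of 1 is harmless,
    since twice a cost is even. *)
Lemma ecc0_is_witness (n m K : nat) (v : coords m) : (1 < n)%N -> (n <= m)%N ->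
  (dist_u0 n m <= K)%N ->
  (n * m.+1 + 2 * ((m - n)./2 * ((m - n)./2).+1) <= (2 * K).+1)%N ->
  is_dist n m v (zero_v m) K -> ecc0_is n m K.
Proof.
move=> n_gt1 n_le_m FK avgK vK; split; last first.
  by exists v; split=> //; case: vK => [[p [[]]]].
move=> w /vertex_enc[s ls ->]; have n0 : (0 < n)%N by lia.
have a_le : ((m - n)./2 <= m)%N by lia.
have [k bound] := cost_bound n m _ s n0 a_le ls.
have [L [dL Lk]] := dist_enc_le n m s k n0 ls; exists L; split=> //.
apply: leq_trans Lk _; case: bound => [[p [ap pm le_p]]|]; last by lia.
exact: leq_trans le_p (leq_trans (dist_u0_ge n m p n_gt1 n_le_m ap pm) FK).
Qed.

(** The averaging bound equals [2 * dist_u0 n m] for even [m - n] and exceeds it by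
    [n - 2 * (a + 1)], possibly negative, for odd [m - n]; the form avoids truncated subtraction. *)
Lemma average_dist_u0 (n m : nat) (a := ((m - n)./2)%N) : (n <= m)%N ->
  (n * m.+1 + 2 * (a * a.+1) + odd (m - n) * (2 * a.+1) =
    2 * dist_u0 n m + odd (m - n) * n)%N.
Proof.
move=> n_le_m; rewrite {}/a /dist_u0 mulnDr !double_bin2S.
have [a [e mE]] : exists a (e : bool), m = (n + 2 * a + e)%N.
  by exists ((m - n)./2), (odd (m - n)); lia.
have -> : (m - n)./2 = a by lia.
have -> : odd (m - n) = e by lia.
have -> : ((m + n)./2 = a + n)%N by lia.
have -> : ((m - n).+1)./2 = (a + e)%N by lia.
by rewrite {}mE; case: e; nia.
Qed.

Local Close Scope ring_scope.

Theorem theorem5p31 (n m : nat) (hn : (1 < n)%N) (hnm : (n <= m)%N) :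
  let F := ('C(((m + n)./2).+1, 2) + 'C(((m - n).+1./2).+1, 2))%N in
  let c := ((m.+2)./2)%N in
  if ((2 %| (m - n)) || (n <= c))%N then
    is_dist n m (u0 n m) (zero_v m) F /\ ecc0_is n m F
  else
    exists K : nat,
      is_dist n m (u0 n m) (zero_v m) K /\
      is_dist n m (u1 n m) (zero_v m) (K + n - c)%N /\
      ecc0_is n m (K + n - c)%N.
Proof.
move=> F c; rewrite -/(dist_u0 n m) in F *.
have avg := average_dist_u0 n m hnm; have d0 := u0_dist n m hn hnm.
rewrite dvdn2; case: ifP => [cond|/negbT/norP[n_odd n_c]].
  split=> //; apply: ecc0_is_witness d0 => //.
  (* For odd [m - n] and [a = floor((m - n) / 2)], the condition [n <= c] amounts to
     [n - 2 * (a + 1) <= 1], which is the allowed slack. *)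
  by move: avg cond; rewrite /c; case: (odd (m - n)) => /=; lia.
rewrite negbK in n_odd; rewrite -ltnNge in n_c.
have d1 := u1_dist n m n_odd hnm n_c.
exists (dist_u0 n m); split=> //; split=> //.
apply: ecc0_is_witness d1 => //; rewrite n_odd in avg.
  by move: n_c; rewrite /c; lia.
(* Here [2 * c <= m + 2 = n + 2 * a + 3], so the excess [n - 2 * (a + 1)] is at most
   [2 * (n - c) + 1]. *)
by move: avg n_c; rewrite /c; lia.
Qed.
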